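(* Let $\mathcal{G}$ be the set of proportionally $2$-choosable graphs and, for each integer $i\ge 2$, let $\mathcal{G}_i$ be the set of proportionally $(2,i)$-choosable graphs. Then $$\mathcal{G}_2 \supsetneq \mathcal{G}_3 \supsetneq \mathcal{G}_4 \supsetneq \mathcal{G}_5 \quad\text{and}\quad \mathcal{G}_\ell = \mathcal{G} \text{ for each integer } \ell \geq 5.$$
   Context: All graphs are nonempty, finite and simple. For $m\in\mathbb{N}=\{1,2,3,\ldots\}$, $[m]=\{1,\ldots,m\}$. A $k$-assignment for a graph $G$ is a function $L$ assigning to each vertex $v$ of $G$ a set $L(v)$ of exactly $k$ colors (from an arbitrary, unbounded set of colors). For integers $1\le k\le \ell$, a $(k,\ell)$-assignment for $G$ is a $k$-assignment $L$ with $L(v)\subseteq[\ell]$ for every $v$. Given a $k$-assignment $L$, let $\mathcal{L}=\bigcup_{v\in V(G)}L(v)$ and, for $c\in\mathcal{L}$, let $\eta(c)=|\{v\in V(G): c\in L(v)\}|$. A proportional $L$-coloring of $G$ is a function $f$ on $V(G)$ with $f(v)\in L(v)$ for every $v$, with $f(u)\ne f(v)$ whenever $u,v$ are adjacent, and with $|f^{-1}(c)|\in\{\lfloor \eta(c)/k\rfloor,\lceil \eta(c)/k\rceil\}$ for every $c\in\mathcal{L}$. $G$ is proportionally $k$-choosable if a proportional $L$-coloring of $G$ exists for every $k$-assignment $L$ for $G$; $G$ is proportionally $(k,\ell)$-choosable if a proportional $L$-coloring of $G$ exists for every $(k,\ell)$-assignment $L$ for $G$. *)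

(* Defs.v *)
(* MathComp, with finmap for finite sets of colors. *)
From mathcomp Require Import all_boot finmap.

Set Implicit Arguments.
Unset Strict Implicit.
Unset Printing Implicit Defensive.

Record sgraph := SGraph {
  vertex :> finType;
  adj : rel vertex;
  adj_sym : symmetric adj;
  adj_irrefl : irreflexive adj;
  vertex_gt0 : 0 < #|vertex|
}.

(* Sets of graphs are predicates: classical_sets' [set sgraph] is ruled out by
   universe constraints, since sgraph lives above finType. *)
Definition graph_set := sgraph -> Prop.

Definition same_graphs (A B : graph_set) : Prop := forall G, A G <-> B G.

Definition strict_superset (A B : graph_set) : Prop :=
  (forall G, B G -> A G) /\ exists G, A G /\ ~ B G.

Definition ceil_div (n k : nat) : nat := (n + k.-1) %/ k.

(* The color type C is a parameter: choosability below ranges over all C. *)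
Definition k_assignment (k : nat) (G : sgraph) (C : choiceType)
    (L : G -> {fset C}) : Prop :=
  forall v : G, #|` L v| = k.

(* Here [l] is {1, ..., l}. *)
Definition kl_assignment (k l : nat) (G : sgraph) (L : G -> {fset nat}) : Prop :=
  k_assignment k L /\ forall (v : G) (c : nat), c \in L v -> 1 <= c <= l.

Definition palette (G : sgraph) (C : choiceType) (L : G -> {fset C}) : {fset C} :=
  (\bigcup_(v <- enum G) L v)%fset.

Definition eta (G : sgraph) (C : choiceType) (L : G -> {fset C}) (c : C) : nat :=
  #|[pred v : G | c \in L v]|.

Definition proportional_coloring (k : nat) (G : sgraph) (C : choiceType)
    (L : G -> {fset C}) (f : G -> C) : Prop :=
  [/\ forall v : G, f v \in L v,
      forall u v : G, adj u v -> f u <> f v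
    & forall c : C, c \in palette L ->
        #|[pred v : G | f v == c]| = eta L c %/ k
        \/ #|[pred v : G | f v == c]| = ceil_div (eta L c) k].

Definition proportionally_choosable (k : nat) : graph_set :=
  fun G => forall (C : choiceType) (L : G -> {fset C}),
    k_assignment k L -> exists f : G -> C, proportional_coloring k L f.

Definition proportionally_kl_choosable (k l : nat) : graph_set :=
  fun G => forall L : G -> {fset nat},
    kl_assignment k l L -> exists f : G -> nat, proportional_coloring k L f.

(* Main.v *)
Require Import Defs.
From mathcomp Require Import all_boot finmap.
From mathcomp Require Import zify.

Set Implicit Arguments.
Unset Strict Implicit.
Unset Printing Implicit Defensive.

(** View the colors as the vertices of a multigraph and each two-element list as an
    edge; a coloring is then an orientation, and it meets the counting condition iff
    in- and out-degree differ by at most one at every color.  Pairing consecutive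
    edges at each color and orienting the resulting trails gives such orientations,
    and two adjacent vertices that are paired at a color never both receive it.
    If some z has at most two neighbors, these are not adjacent, and G - z has
    maximum degree at most one, a suitable pairing and the reversal of trails give a
    proportional coloring from arbitrary lists.  A graph without such a z contains an
    odd cycle, C4, K_{1,3} or 2 P3, each of which has bad lists from five colors,
    whatever the rest of the graph.  The strict inclusions are witnessed by C4, P6
    and P7; the last two are handled by exhaustive search. *)

(** * Signs alternating along two involutions *)

Lemma free_involutions_2coloring (T : finType) (s t : T -> T) :
  involutive s -> involutive t -> (forall x, s x != x) -> (forall x, t x != x) ->
  exists o : T -> bool,
    (forall x, o (s x) = ~~ o x) /\ (forall x, o (t x) = ~~ o x).
Proof.
(* s exchanges the orbits of x and s x under t \o s, and these are distinct. *)
move=> sK tK s_free t_free; pose g := t \o s.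
have g_inj : injective g by apply: inj_comp; apply: can_inj; eassumption.
have sg x n : iter n g (s (iter n g x)) = s x.
  elim: n => // n IHn; rewrite -[RHS]IHn [LHS]iterSr; congr (iter n g _).
  by rewrite /g /= sK tK.
(* If the k-th iterate of [g] sends x to s x, then [sg] at the midpoint z of this orbit segment
   gives s z = z for k even and t (s z) = s z for k odd. *)
have sep x : ~~ fconnect g x (s x).
  apply/negP => /iter_findex; set k := findex _ _ _ => gk.
  have injI n : injective (iter n g) by elim: n => //= n IHn; apply: inj_comp.
  have := odd_double_half k; set j := k./2; rewrite -addnn.
  move: gk => /[swap] <-; set z := iter j g x.
  case: (odd k) => /=; rewrite ?add0n iterD -/z -(sg x j) -/z => gk.
    have : iter j g (g z) = iter j g (s z) by rewrite -iterSr.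
    move/(@injI _ _ _)=> /eqP.
    by apply/negP; rewrite /g /=; apply: t_free.
  have /eqP := injI _ _ _ gk.
  by apply/negP; rewrite eq_sym; apply: s_free.
have gS := fconnect_sym g_inj.
(* The rank of its root names an orbit of [g]; the sign of x compares the names of the two orbits
   that s exchanges. *)
pose r x := enum_rank (froot g x).
have r_g x : r (g x) = r x.
  by congr enum_rank; apply/esym/(rootP gS); apply: fconnect1.
have r_s x : r x != r (s x).
  by apply: contra (sep x) => /eqP/enum_rank_inj/(rootP gS).
exists (fun x => r x < r (s x)); split=> x.
  by rewrite sK; have := r_s x; rewrite -val_eqE /=; case: ltngtP.
have -> : r (t x) = r (s x) by rewrite -(r_g (s x)) /g /= sK.
have -> : r (s (t x)) = r x by rewrite -(r_g (s (t x))) /g /= sK tK.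
by have := r_s x; rewrite -val_eqE /=; case: ltngtP.
Qed.

(* Doubling the carrier makes the fixed points of t harmless. *)
Lemma involutions_2coloring (T : finType) (s t : T -> T) :
  involutive s -> involutive t -> (forall x, s x != x) ->
  exists o : T -> bool,
    (forall x, o (s x) = ~~ o x) /\ (forall x, t x != x -> o (t x) = ~~ o x).
Proof.
move=> sK tK s_free.
pose s2 (x : T * bool) := (s x.1, x.2).
pose t2 (x : T * bool) := if t x.1 == x.1 then (x.1, ~~ x.2) else (t x.1, x.2).
have [|||| o [os ot]] := @free_involutions_2coloring _ s2 t2.
- by case=> x b; rewrite /s2 /= sK.
- case=> x b; rewrite /t2 /=; have [fx|nfx] := eqVneq (t x) x; rewrite /=.
    by rewrite fx eqxx negbK.
  by rewrite tK eq_sym (negbTE nfx).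
- by case=> x b; rewrite -pair_eqE /= negb_and s_free.
- case=> x b; rewrite /t2 /=; case: ifPn => nfx; rewrite -pair_eqE /= negb_and.
    by case: b; rewrite orbT.
  by rewrite nfx.
exists (fun x => o (x, true)); split=> [x|x nfx]; first exact: (os (x, true)).
by rewrite -(ot (x, true)) /t2 /= (negbTE nfx).
Qed.

(** Induction on the number of fixed points: two fixed points of one color are swapped, until each
    color has at most one left. *)
Lemma extend_pairing (T : finType) (C : eqType) (col : T -> C) (h : T -> T) :
  involutive h -> (forall x, col (h x) = col x) ->
  exists t : T -> T, [/\ involutive t, forall x, col (t x) = col x,
    forall x, h x != x -> t x = h x
    & forall x y, t x = x -> t y = y -> col x = col y -> x = y].
Proof.
have [n] := ubnP #|[pred x | h x == x]|; elim: n h => // n IHn h le_n hK colh.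
have [/existsP[x /existsP[y /and4P[xy /eqP hx /eqP hy /eqP cxy]]]|nex] :=
  boolP [exists x, exists y, [&& x != y, h x == x, h y == y & col x == col y]].
  pose h1 z := if z == x then y else if z == y then x else h z.
  have h1x : h1 x = y by rewrite /h1 eqxx.
  have h1y : h1 y = x by rewrite /h1 eqxx eq_sym (negbTE xy).
  have h1z z : z != x -> z != y -> h1 z = h z.
    by rewrite /h1 => /negbTE-> /negbTE->.
  have [|z|z|t [tK colt th tfix]] := IHn h1.
  - rewrite -ltnS; apply: leq_trans le_n; rewrite ltnS.
    apply: proper_card; apply/properP; split.
      apply/subsetP=> z; rewrite !inE.
      have [->|zx] := eqVneq z x; first by rewrite h1x eq_sym (negbTE xy).
      have [->|zy] := eqVneq z y; first by rewrite h1y (negbTE xy).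
      by rewrite h1z.
    by exists x; rewrite !inE ?hx ?eqxx // h1x eq_sym.
  - have [->|zx] := eqVneq z x; first by rewrite h1x h1y.
    have [->|zy] := eqVneq z y; first by rewrite h1y h1x.
    rewrite (h1z z) // h1z ?hK //.
      by apply: contra zx => /eqP e; rewrite -(hK z) e hx.
    by apply: contra zy => /eqP e; rewrite -(hK z) e hy.
  - have [->|zx] := eqVneq z x; first by rewrite h1x.
    have [->|zy] := eqVneq z y; first by rewrite h1y.
    by rewrite h1z.
  exists t; split=> // z hz; have zx: z != x by apply: contra hz => /eqP->; rewrite hx.
  have zy: z != y by apply: contra hz => /eqP->; rewrite hy.
  by rewrite th h1z.
exists h; split=> // x y hx hy cxy; apply/eqP; apply: contraNT nex => xy.
by apply/existsP; exists x; apply/existsP; exists y; rewrite xy hx hy cxy !eqxx.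
Qed.

(** * Balanced colorings with prescribed pairings *)

Lemma half_or_ceil_div2 p q : p <= q.+1 -> q <= p.+1 ->
  p = (p + q) %/ 2 \/ p = ceil_div (p + q) 2.
Proof. rewrite /ceil_div /=; lia. Qed.

(* Colors are the vertices and the lists are the edges of a multigraph, which is
   oriented along trails; [R c] prescribes which edges are consecutive at [c]. *)
Lemma balanced_coloring (G : sgraph) (C : choiceType) (L : G -> {fset C})
    (R : C -> rel G) :
  k_assignment 2 L ->
  (forall c, symmetric (R c)) -> (forall c, irreflexive (R c)) ->
  (forall c u v, R c u v -> c \in L u) ->
  (forall c u v w, R c u v -> R c u w -> v = w) ->
  forall v0 c0, c0 \in L v0 ->
  exists f : G -> C, [/\ f v0 = c0, forall v, f v \in L v,
    forall c u v, R c u v -> (f u == c) = (f v != c)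
    & forall c, #|[pred v : G | f v == c]| = eta L c %/ 2
        \/ #|[pred v : G | f v == c]| = ceil_div (eta L c) 2].
Proof.
move=> L2 Rsym Rirr RL Rfun v0 c0 c0v0.
(* A pair (v, b) is a half-edge: the end of the edge v at entry b of its list. Lists have two
   entries, so the default [c0] is never reached. *)
pose col (x : G * bool) := nth c0 (L x.1) x.2.
have memL v c : (c \in L v) = (c == col (v, false)) || (c == col (v, true)).
  rewrite /col /= -[c \in L v]/(c \in enum_fset (L v)); have := L2 v.
  by case: (enum_fset (L v)) => [|x [|y []]] //= _; rewrite !inE.
have colN v : col (v, true) != col (v, false).
  rewrite /col /=; have := L2 v; have := fset_uniq (L v).
  by case: (enum_fset (L v)) => [|x [|y []]] //=; rewrite inE andbT eq_sym.
pose g c u := if [pick v | R c u v] is Some v then v else u.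
have gR c u v : R c u v -> g c u = v.
  by rewrite /g => uv; case: pickP => [w uw|/(_ v)]; [exact: Rfun uw uv|rewrite uv].
have gP c u : g c u = u \/ R c u (g c u).
  by rewrite /g; case: pickP => [w uw|_]; [right|left].
have gK c : involutive (g c).
  move=> u; case: (gP c u) => [e|]; first by rewrite !e.
  by rewrite Rsym => /gR.
have gL c u : c \in L u -> c \in L (g c u).
  by case: (gP c u) => [->//|]; rewrite Rsym => /RL.
pose at_ u c : G * bool := (u, col (u, true) == c).
have colat u c : c \in L u -> col (at_ u c) = c.
  rewrite memL /at_ => /orP[]/eqP->; last by rewrite eqxx.
  by rewrite (negbTE (colN u)).
have atcol x : at_ x.1 (col x) = x.
  case: x => u [] /=; rewrite /at_ ?eqxx //.
  by rewrite (negbTE (colN u)).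
have colL x : col x \in L x.1.
  by case: x => u []; rewrite memL eqxx ?orbT.
(* [h] exchanges the half-edges at c of two edges related by [R c] and fixes all others. *)
pose h x := at_ (g (col x) x.1) (col x).
have colh x : col (h x) = col x by rewrite /h colat // gL.
have hK : involutive h.
  by move=> x; rewrite /h -/(h x) colh [(h x).1]/= gK atcol.
have [t [tK colt th tfix]] := extend_pairing hK colh.
have [|||o [os ot]] := @involutions_2coloring _ (fun x : G * bool => (x.1, ~~ x.2)) t.
- by case=> u b /=; rewrite negbK.
- by [].
- by case=> u []; rewrite -pair_eqE /= andbF.
(* Each edge points to its end of sign [p]. Taking for [p] the sign of v0 at [c0], which amounts to
   reversing all trails if necessary, gives v0 the color [c0]. *)
pose p := o (at_ v0 c0).
have in_or_out u c : c \in L u -> (col (u, o (u, true) == p) == c) = (o (at_ u c) == p).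
  have := os (u, true); rewrite /= /at_ memL => o_f /orP[]/eqP->.
    rewrite (negbTE (colN u)) o_f; case: (o _); case: (p); rewrite ?eqxx //=.
    - by rewrite (negbTE (colN u)).
    - by rewrite (negbTE (colN u)).
  rewrite eqxx; case: (o _); case: (p); rewrite ?eqxx //= eq_sym.
  - by rewrite (negbTE (colN u)).
  - by rewrite (negbTE (colN u)).
pose f u := col (u, o (u, true) == p).
have fL v : f v \in L v by exact: (colL (v, _)).
exists f; split=> //.
- by apply/eqP; rewrite in_or_out.
- move=> c u v uv; have cu := RL _ _ _ uv.
  have cv : c \in L v by move: uv; rewrite Rsym => /RL.
  rewrite !in_or_out //.
  have hu : h (at_ u c) = at_ v c by rewrite /h colat //= (gR _ _ _ uv).
  have nvu : h (at_ u c) != at_ u c.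
    rewrite hu; apply/eqP => -[e _]; by move: uv; rewrite e Rirr.
  rewrite -hu -(th _ nvu) ot ?th //.
  by case: (o _); case: (p).
move=> c.
pose S := [set v | c \in L v]; pose F := [set v | f v == c].
have FS : F \subset S by apply/subsetP=> v; rewrite !inE => /eqP<-.
have etaE : eta L c = #|F| + #|S :\: F|.
  rewrite -{1}(setIidPr FS) cardsID.
  by apply: eq_card => v; rewrite !inE.
have -> : #|[pred v : G | f v == c]| = #|F| by apply: eq_card => v; rewrite !inE.
pose k v := (t (at_ v c)).1.
have kL v : v \in S -> at_ (k v) c = t (at_ v c).
  by rewrite inE => cv; rewrite -{1}(colat _ _ cv) -(colt (at_ v c)) atcol.
have kinS v : v \in S -> k v \in S.
  by move=> vS; have := vS; rewrite !inE => cv; rewrite -(colat _ _ cv) -colt colL.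
have kK v : v \in S -> k (k v) = v.
  by move=> vS; rewrite {1}/k kL // tK.
have kF v : v \in S -> k v != v -> (k v \in F) = (v \notin F).
  move=> vS; have := vS; have := kinS _ vS; rewrite !inE => ckv cv nkv.
  rewrite !in_or_out // kL // ot; first by case: (o _); case: (p).
  by apply: contra nkv => /eqP e; rewrite /k e.
have kfix v w : v \in S -> w \in S -> k v = v -> k w = w -> v = w.
  move=> vS wS kv kw; suff [] : at_ v c = at_ w c by [].
  apply: tfix; rewrite -?kL ?kv ?kw //.
  by move: vS wS; rewrite !inE => cv cw; rewrite !colat.
(* [k] maps the vertices of A that it moves injectively into B, and it fixes at most one vertex of
   S. *)
have le1 (A B : {set G}) : A \subset S ->
    (forall v, v \in A -> k v != v -> k v \in B) -> #|A| <= #|B|.+1.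
  move=> AS AB; pose D := [set v in A | k v != v].
  have cD : #|D| <= #|B|.
    rewrite -(card_in_imset (f := k) (D := D)).
      by apply/subset_leq_card/subsetP=> _ /imsetP[v + ->]; rewrite inE => /andP[]; apply: AB.
    move=> v w; rewrite !inE => /andP[/(subsetP AS) vS _] /andP[/(subsetP AS) wS _] e.
    by rewrite -(kK _ vS) e kK.
  have DA : D \subset A by apply/subsetP=> v; rewrite inE => /andP[].
  have <- : #|D| + #|A :\: D| = #|A| by rewrite -{1}(setIidPr DA) cardsID.
  rewrite -addn1 leq_add // leqNgt; apply/negP=> /card_gt1P[v [w [vD wD /eqP vw]]].
  apply: vw; move: vD wD; rewrite !inE !negb_and !negbK => /andP[+ vA] /andP[+ wA].
  rewrite vA wA /= => /eqP kv /eqP kw.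
  by apply: kfix => //; apply: (subsetP AS).
rewrite etaE; apply: half_or_ceil_div2.
  by apply: le1 => // v vF nkv; rewrite inE kF ?kinS ?vF ?(subsetP FS).
apply: le1 => [|v]; first exact: subsetDl.
by rewrite inE => /andP[vF vS] nkv; rewrite kF.
Qed.

(** * Graphs with a center are choosable *)

Lemma fset_pair_eq (K : choiceType) (A : {fset K}) (c d : K) :
  #|` A| = 2 -> c != d -> c \in A -> d \in A -> A = [fset c; d]%fset.
Proof.
move=> A2 cd cA dA; apply/esym/eqP.
by rewrite eqEfcard fsubUset !fsub1set cA dA A2 cardfs2 cd.
Qed.

Lemma fset_pairP (K : choiceType) (A : {fset K}) :
  #|` A| = 2 -> exists c d, c != d /\ A = [fset c; d]%fset.
Proof.
move=> A2; have /fset0Pn[c cA] : A != fset0 by rewrite -cardfs_gt0 A2.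
have /fset0Pn[d] : (A `\ c)%fset != fset0.
  by rewrite -cardfs_gt0; move: A2; rewrite (cardfsD1 c) cA add1n => -[->].
rewrite !inE eq_sym => /andP[cd dA]; exists c, d; split=> //.
exact: fset_pair_eq.
Qed.

(** The existence of such a z turns out to characterize the proportionally 2-choosable graphs. *)
Definition matching_but_center (G : sgraph) (z : G) : Prop :=
  [/\ forall u v w, u != z -> v != z -> w != z -> adj u v -> adj u w -> v = w,
      forall u v w, adj z u -> adj z v -> adj z w -> [\/ u = v, u = w | v = w]
    & forall u v, adj z u -> adj z v -> ~~ adj u v].

(** Either some color of L z occurs at no more than one neighbor of z ([caseI]), or both colors
    occur at two neighbors, so that z and its two neighbors share one list ([caseII]). *)
Lemma choosable_of_center (G : sgraph) (z : G) :
  matching_but_center z -> proportionally_choosable 2 G.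
Proof.
move=> [Gmatch zdeg ztri] C L L2.
have adjC (u v : G) : adj u v = adj v u by exact: adj_sym.
have adjN (u v : G) : adj u v -> u != v.
  by apply: contraTneq => ->; rewrite adj_irrefl.
pose one_nbr c := forall u v, adj z u -> adj z v -> c \in L u -> c \in L v -> u = v.
(* Color z with c and pair it with its only neighbor that has c; any other edge
   that could become monochromatic is paired. *)
have caseI c : c \in L z -> one_nbr c -> exists f, proportional_coloring 2 L f.
  move=> cz c1.
  pose away u := (u != z) && ~~ adj z u.
  pose R e u v := [&& adj u v, e \in L u, e \in L v
    & if e == c then [|| u == z, v == z | away u && away v] else (u != z) && (v != z)].
  have [|e u|e u v|e u v w|f [fz fL fR fbal]] := @balanced_coloring G C L R L2 _ _ _ _ z c cz.
  - move=> e u v; rewrite /R adjC; case: (e == c); case: (e \in L u); case: (e \in L v) => //=.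
      by rewrite orbCA (andbC (away u)).
    by rewrite (andbC (u != z)).
  - by rewrite /R adj_irrefl.
  - by case/and4P.
  - case/and4P=> uv eu ev + /and4P[uw _ ew +].
    case: eqP => [ec|_]; last first.
      by move=> /andP[uz vz] /andP[_ wz]; apply: Gmatch uv uw.
    have [uz _ _|uz] := eqVneq u z.
      by subst; apply: c1.
    have [vz _|vz] := eqVneq v z.
      have [->//|wz] := eqVneq w z; rewrite /away uz /= -{1}vz adjC uv //.
    have [wz|wz _ _] := eqVneq w z; last exact: Gmatch uv uw.
    by rewrite /away uz /= -{1}wz adjC uw.
  exists f; split=> // u v uv fuv.
  have fneq e : f u = e -> ~~ R e u v.
    by move=> fu; apply/negP=> /fR; rewrite -fuv fu eqxx.
  have euv : (f u \in L u) && (f u \in L v) by rewrite fL fuv fL.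
  have := fneq _ erefl; rewrite /R uv /=; move/andP: euv => [-> ->] /=.
  (* An edge with c at both ends that is not paired at c has an end adjacent to z; that end is
     paired with z, which already has c. An edge not paired at another color has z as an end. *)
  case: eqP => [fu|nfu].
    rewrite !negb_or => /and3P[uz vz]; rewrite /away uz vz /= -negb_or negbK.
    have cu : c \in L u by rewrite -fu.
    have cv : c \in L v by rewrite -fu fuv.
    case/orP=> zx.
      have /fR : R c z u by rewrite /R zx cz cu !eqxx.
      by rewrite fz fu eqxx.
    have /fR : R c z v by rewrite /R zx cz cv !eqxx.
    by rewrite fz -fuv fu eqxx.
  rewrite negb_and !negbK => /orP[]/eqP e; apply: nfu; first by rewrite e.
  by rewrite fuv e.
(* Here z and its neighbors y1, y2 have the list {c, d}.  Pairing z with y1 at c and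
   with y2 at d forces f y1 = f y2, so only the other edges at y1 and y2 matter, and
   the prescribed value of f y1 takes care of them. *)
have caseII y1 y2 c d : y1 != y2 -> adj z y1 -> adj z y2 -> c != d ->
    c \in L z -> d \in L z -> L y1 = L z -> L y2 = L z ->
    (forall x1 x2, adj y1 x1 -> adj y2 x2 -> x1 != z -> x2 != z ->
      c \in L x1 -> d \in L x2 -> (d \in L x1) || (c \in L x2)) ->
    exists f, proportional_coloring 2 L f.
  move=> y12 zy1 zy2 cd cz dz Ly1 Ly2 Hx.
  have Lz e : (e \in L z) = (e == c) || (e == d).
    by rewrite (fset_pair_eq (L2 z) cd cz dz) !inE.
  (* [ex y1 y2] describes the edges dropped from the pairing at c: z y2, and the edges from y1 that
     avoid z. [ex y2 y1] does the same at d. What remains at each color is a matching. *)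
  pose ex y y' u v := (u == z) && (v == y') || (u == y) && (v != z).
  pose R e u v := [&& adj u v, e \in L u, e \in L v,
    ~~ ((e == c) && (ex y1 y2 u v || ex y1 y2 v u))
    & ~~ ((e == d) && (ex y2 y1 u v || ex y2 y1 v u))].
  have y1z : y1 != z by rewrite eq_sym adjN.
  have y2z : y2 != z by rewrite eq_sym adjN.
  have zN u : adj z u -> u = y1 \/ u = y2.
    by move=> zu; case: (zdeg _ _ _ zu zy1 zy2) => [->|->|e]; [left|right|rewrite e eqxx in y12].
  have Rsym e : symmetric (R e).
    move=> u v; rewrite /R adjC (orbC (ex y1 y2 u v)) (orbC (ex y2 y1 u v)).
    by case: (e \in L u); case: (e \in L v).
  have Rfun e u v w : R e u v -> R e u w -> v = w.
    case/and5P=> uv eu ev + + /and5P[uw _ ew + +].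
    have [uz|uz] := eqVneq u z.
      move: uv uw eu; rewrite uz Lz => /zN zv /zN zw /orP[]/eqP->;
        by case: zv zw => -> [] -> //; rewrite /ex !eqxx ?orbT.
    have onez x y : adj u x -> x = z -> e \in L x -> adj u y -> y != z ->
      ~~ ((e == c) && (ex y1 y2 u x || ex y1 y2 x u)) ->
      ~~ ((e == d) && (ex y2 y1 u x || ex y2 y1 x u)) ->
      ~~ ((e == c) && (ex y1 y2 u y || ex y1 y2 y u)) ->
      ~~ ((e == d) && (ex y2 y1 u y || ex y2 y1 y u)) -> False.
      move=> ux xz + uy yz; move: ux; rewrite xz adjC Lz => /zN ux /orP[]/eqP->;
        case: ux => ->; rewrite /ex;
        by rewrite !eqxx ?yz ?orbT //= ?andbT ?orbT.
    have [vz|vz] := eqVneq v z; have [wz|wz] := eqVneq w z.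
    - by rewrite vz wz.
    - by move=> c1 d1 c2 d2; case: (onez v w).
    - by move=> c1 d1 c2 d2; case: (onez w v).
    by move=> _ _ _ _; apply: Gmatch uv uw.
  (* The outer edge at y1 is not paired at c. If its other end x has d as well, the pairing at d
     keeps c from both ends; if not, y1 is given d. *)
  pose b := [exists x, [&& adj y1 x, x != z, c \in L x & d \notin L x]].
  have [e u|e u v||f [fq fL fR fbal]] :=
    @balanced_coloring G C L R L2 Rsym _ _ Rfun y1 (if b then d else c).
  - by rewrite /R adj_irrefl.
  - by case/and5P.
  - by rewrite Ly1; case: b.
  exists f; split=> //.
  have neqs := (negbTE cd, negbTE y12, negbTE y1z, negbTE y2z, eq_sym d c, eq_sym y2 y1,
    eq_sym z y1, eq_sym z y2).
  have Rc1 : R c z y1 by rewrite /R zy1 Ly1 cz /ex !(eqxx, neqs).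
  have Rd2 : R d z y2 by rewrite /R zy2 Ly2 dz /ex !(eqxx, neqs).
  have two x : L x = L z -> f x = if f x == c then c else d.
    move=> Lx; have := fL x; rewrite Lx Lz => /orP[]/eqP->; first by rewrite eqxx.
    by rewrite eq_sym (negbTE cd).
  have fz1 : f z <> f y1.
    by have := fR _ _ _ Rc1 => + e; rewrite e; case: eqP.
  have fz2 : f z <> f y2.
    by have := fR _ _ _ Rd2 => + e; rewrite e; case: eqP.
  have f12 : f y1 = f y2.
    move: fz1 fz2; rewrite (two z erefl) (two y1 Ly1) (two y2 Ly2).
    by case: eqP; case: eqP; case: eqP.
  have xy12 x : adj y1 x -> x != y2 by apply: contraTneq => ->; apply: ztri.
  have xy21 x : adj y2 x -> x != y1 by apply: contraTneq => ->; apply: ztri.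
  have propc u v : adj u v -> ex y1 y2 u v -> f u = c -> f v = c -> False.
    move=> y1v /orP[/andP[/eqP uz /eqP vy]|/andP[/eqP uy vz]] fu fv.
      by rewrite -uz -vy fu fv in fz2.
    rewrite {u}uy in y1v fu; have cv : c \in L v by rewrite -fv.
    have [dv|dv] := boolP (d \in L v).
      have /fR : R d y1 v.
        by rewrite /R y1v Ly1 dz dv /ex !(eqxx, neqs) (negbTE vz) (negbTE (xy12 _ y1v)).
      by rewrite fu fv (negbTE cd).
    have bT : b by apply/existsP; exists v; rewrite y1v vz cv dv.
    by move: fu; rewrite fq bT => /esym/eqP; apply/negP.
  have propd u v : adj u v -> ex y2 y1 u v -> f u = d -> f v = d -> False.
    move=> y2v /orP[/andP[/eqP uz /eqP vy]|/andP[/eqP uy vz]] fu fv.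
      by rewrite -uz -vy fu fv in fz1.
    rewrite {u}uy in y2v fu; have dv : d \in L v by rewrite -fv.
    have [cv|cv] := boolP (c \in L v).
      have /fR : R c y2 v.
        by rewrite /R y2v Ly2 cz cv /ex !(eqxx, neqs) (negbTE vz) (negbTE (xy21 _ y2v)).
      by rewrite fu fv eq_sym (negbTE cd).
    (* Since y1 also has d, its outer neighbor has c but not d, while v has d but not c, against
       [Hx]. *)
    move: fq; rewrite f12 fu /b; case: existsP => [[x /and4P[y1x xz cx dx]] _|_ /esym/eqP].
      by have := Hx _ _ y1x y2v xz vz cx dv; rewrite (negbTE dx) (negbTE cv).
    by apply/negP.
  move=> u v uv fuv.
  have fuLv : f u \in L v by rewrite fuv fL.
  have : ~~ R (f u) u v by apply/negP=> /fR; rewrite fuv eqxx.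
  rewrite /R uv fL fuLv /= negb_and !negbK.
  have vu : adj v u by rewrite adjC.
  case/orP=> /andP[/eqP fu /orP[]].
  - by move/(propc _ _ uv); apply; rewrite -?fuv.
  - by move/(propc _ _ vu); apply; rewrite -?fuv.
  - by move/(propd _ _ uv); apply; rewrite -?fuv.
  - by move/(propd _ _ vu); apply; rewrite -?fuv.
have or_two c : c \in L z -> (exists f, proportional_coloring 2 L f) \/
    exists u v, [/\ u != v, adj z u, adj z v, c \in L u & c \in L v].
  move=> cz; pose P u v := [&& adj z u, adj z v, c \in L u & c \in L v].
  have [/existsP[u /existsP[v /andP[uv /and4P[]]]]|none] :=
    boolP [exists u, exists v, (u != v) && P u v]; first by right; exists u, v.
  left; apply: caseI cz _ => u v zu zv cu cv; apply/eqP; apply: contraNT none => uv.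
  by apply/existsP; exists u; apply/existsP; exists v; rewrite uv /P zu zv cu cv.
have [c [d [cd Lz]]] := fset_pairP (L2 z).
have cz : c \in L z by rewrite Lz !inE eqxx.
have dz : d \in L z by rewrite Lz !inE eqxx orbT.
have [//|[y1 [y2 [y12 zy1 zy2 cy1 cy2]]]] := or_two c cz.
have [//|[w1 [w2 [w12 zw1 zw2 dw1 dw2]]]] := or_two d dz.
have dy : (d \in L y1) && (d \in L y2).
  have w_y w : adj z w -> w = y1 \/ w = y2.
    by move=> zw; case: (zdeg _ _ _ zw zy1 zy2) => [->|->|e]; [left|right|rewrite e eqxx in y12].
  case: (w_y _ zw1) (w_y _ zw2) => e1 [] e2; move: dw1 dw2 w12;
    by rewrite e1 e2 ?eqxx // => -> ->.
have Lfull x : c \in L x -> d \in L x -> L x = L z.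
  by move=> cx dx; rewrite Lz; apply: fset_pair_eq.
have /andP[dy1 dy2] := dy.
have Ly1 := Lfull _ cy1 dy1; have Ly2 := Lfull _ cy2 dy2.
(* If the condition of [caseII] fails, the only outer neighbor of y1 lacks d, so the condition with
   c and d interchanged holds vacuously. *)
pose bad x1 x2 := [&& adj y1 x1, adj y2 x2, (x1 != z) && (x2 != z), (c \in L x1) && (d \in L x2)
  & ~~ ((d \in L x1) || (c \in L x2))].
have [/existsP[x1 /existsP[x2 /and5P[yx1 yx2 /andP[x1z x2z] _ nb]]]|none] :=
  boolP [exists x1, exists x2, bad x1 x2].
  apply: (caseII y1 y2 d c) => //; first by rewrite eq_sym.
  move=> t1 t2 yt1 yt2 t1z t2z dt1 ct2; move: nb.
  have y1z : y1 != z by rewrite eq_sym adjN.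
  by rewrite (Gmatch _ _ _ y1z x1z t1z yx1 yt1) dt1.
apply: (caseII y1 y2 c d) => // x1 x2 yx1 yx2 x1z x2z cx1 dx2.
apply: contraNT none => nb; apply/existsP; exists x1; apply/existsP; exists x2.
by rewrite /bad yx1 yx2 x1z x2z cx1 dx2 nb.
Qed.

(** * Bad lists *)

(** An even multiplicity makes floor and ceiling agree, so the number of uses of c is forced. *)
Lemma count_color (G : sgraph) (C : choiceType) (L : G -> {fset C}) (f : G -> C)
    (c : C) (s : seq G) (k : nat) :
  proportional_coloring 2 L f -> uniq s -> size s = k.*2 -> 0 < k ->
  (forall v, (c \in L v) = (v \in s)) -> count (fun v => f v == c) s = k.
Proof.
move=> [fL _ fbal] s_uniq s_size k_gt0 Ls.
have c_pal : c \in palette L.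
  case: s s_size Ls {s_uniq} => [|v s] s_size Ls; first by move: s_size => /=; lia.
  by apply/bigfcupP; exists v; rewrite ?mem_enum // Ls inE eqxx.
have etaE : eta L c = k.*2.
  by rewrite -s_size -(card_uniqP s_uniq); apply: eq_card => v; rewrite !inE Ls.
have <- : #|[pred v : G | f v == c]| = count (fun v => f v == c) s.
  rewrite -size_filter -(card_uniqP (filter_uniq _ s_uniq)); apply: eq_card => v.
  by rewrite !inE mem_filter; case: eqP => //= fv; rewrite -Ls -fv fL.
have := fbal c c_pal; rewrite etaE /ceil_div /=; lia.
Qed.

(** Color 1 appears at an end of each path, hence at neither middle vertex, yet a2 or b2 must have
    it. The paths need not be induced. Vertices off the paths get the list {1, 5}, so four colors
    suffice when there are none. *)
Lemma not_choosable_2P3 (G : sgraph) (l : nat) (a1 a2 a3 b1 b2 b3 : G) :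
  uniq ([:: a1; a3] ++ [:: a2; b2] ++ [:: b1; b3]) ->
  adj a1 a2 -> adj a2 a3 -> adj b1 b2 -> adj b2 b3 ->
  4 <= l ->
  5 <= l \/ (forall v : G, v \in [:: a1; a3] ++ [:: a2; b2] ++ [:: b1; b3]) ->
  ~ proportionally_kl_choosable 2 l G.
Proof.
set s2 := [:: a1; a3]; set s3 := [:: a2; b2]; set s4 := [:: b1; b3].
move=> Gu a12 a23 b12 b23 l4 l5 Gch.
pose L (v : G) := [fset 1; if v \in s2 then 2 else if v \in s3 then 3
                     else if v \in s4 then 4 else 5]%fset.
have [|f fP] := Gch L.
  split=> v; first by rewrite cardfs2; do 3?case: ifP => // _.
  move=> c; rewrite !in_fset2 => /orP[/eqP->|]; first by lia.
  case: ifP => [_ /eqP->|n2]; first by lia.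
  case: ifP => [_ /eqP->|n3]; first by lia.
  case: ifP => [_ /eqP->|n4 /eqP->]; first by lia.
  by case: l5 => [|/(_ v)]; [lia|rewrite !mem_cat n2 n3 n4].
(* Colors 2, 3 and 4 are each used once, so exactly one vertex of each of s2, s3,
   s4 gets color 1. *)
have [fL fadj _] := fP.
move: Gu; rewrite !cat_uniq has_cat negb_or.
case/and3P=> u2 /andP[/hasPn d32 /hasPn d42] /and3P[u3 /hasPn d43 u4].
have c2 : count (fun v => f v == 2) s2 = 1.
  by apply: (count_color fP) => // v; rewrite in_fset2; do 3?case: ifP.
have c3 : count (fun v => f v == 3) s3 = 1.
  apply: (count_color fP) => // v; rewrite in_fset2.
  case: ifP => [v2|_]; last by do 2?case: ifP.
  by apply/esym/negP=> /d32; rewrite /= v2.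
have c4 : count (fun v => f v == 4) s4 = 1.
  apply: (count_color fP) => // v; rewrite in_fset2.
  case: ifP => [v2|_]; first by apply/esym/negP=> /d42; rewrite /= v2.
  case: ifP => [v3|_]; last by case: ifP.
  by apply/esym/negP=> /d43; rewrite /= v3.
have f2 v : v \in s2 -> (f v == 1) || (f v == 2).
  by move=> v2; have := fL v; rewrite in_fset2 v2.
have f3 v : v \in s3 -> (f v == 1) || (f v == 3).
  by move=> v3; have := fL v; rewrite in_fset2 (negbTE (d32 _ v3)) v3.
have f4 v : v \in s4 -> (f v == 1) || (f v == 4).
  by move=> v4; have := fL v; rewrite in_fset2 (negbTE (d42 _ v4)) (negbTE (d43 _ v4)) v4.
have := fadj _ _ a12; have := fadj _ _ a23; have := fadj _ _ b12; have := fadj _ _ b23.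
move: (f2 a1) (f2 a3) (f3 a2) (f3 b2) (f4 b1) (f4 b3) c2 c3 c4.
rewrite !inE !eqxx !orbT /=; move: (f a1) (f a2) (f a3) (f b1) (f b2) (f b3).
by move=> ? ? ? ? ? ? /(_ isT)/pred2P[]-> /(_ isT)/pred2P[]-> /(_ isT)/pred2P[]-> /(_ isT)/pred2P[]-> /(_ isT)/pred2P[]-> /(_ isT)/pred2P[]-> //.
Qed.

(** Colors 2 and 3 are each used once, so one vertex of {a, c} and one of {b, d} get color 1, and
    these are adjacent. *)
Lemma not_choosable_C4 (G : sgraph) (l : nat) (a b c d : G) :
  uniq ([:: a; c] ++ [:: b; d]) ->
  adj a b -> adj b c -> adj c d -> adj d a ->
  3 <= l -> 4 <= l \/ (forall v : G, v \in [:: a; c] ++ [:: b; d]) ->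
  ~ proportionally_kl_choosable 2 l G.
Proof.
set s2 := [:: a; c]; set s3 := [:: b; d].
move=> Gu ab bc cd da l3 l4 Gch.
pose L (v : G) := [fset 1; if v \in s2 then 2 else if v \in s3 then 3 else 4]%fset.
have [|f fP] := Gch L.
  split=> v; first by rewrite cardfs2; do 2?case: ifP => // _.
  move=> e; rewrite !in_fset2 => /orP[/eqP->|]; first by lia.
  case: ifP => [_ /eqP->|n2]; first by lia.
  case: ifP => [_ /eqP->|n3 /eqP->]; first by lia.
  by case: l4 => [|/(_ v)]; [lia|rewrite !mem_cat n2 n3].
have [fL fadj _] := fP.
move: Gu; rewrite !cat_uniq; case/and3P=> u2 /hasPn d32 u3.
have c2 : count (fun v => f v == 2) s2 = 1.
  by apply: (count_color fP) => // v; rewrite in_fset2; do 2?case: ifP.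
have c3 : count (fun v => f v == 3) s3 = 1.
  apply: (count_color fP) => // v; rewrite in_fset2.
  case: ifP => [v2|_]; last by case: ifP.
  by apply/esym/negP=> /d32; rewrite /= v2.
have f2 v : v \in s2 -> (f v == 1) || (f v == 2).
  by move=> v2; have := fL v; rewrite in_fset2 v2.
have f3 v : v \in s3 -> (f v == 1) || (f v == 3).
  by move=> v3; have := fL v; rewrite in_fset2 (negbTE (d32 _ v3)) v3.
have := fadj _ _ ab; have := fadj _ _ bc; have := fadj _ _ cd; have := fadj _ _ da.
move: (f2 a) (f2 c) (f3 b) (f3 d) c2 c3.
rewrite !inE !eqxx !orbT /=; move: (f a) (f b) (f c) (f d).
by move=> ? ? ? ? /(_ isT)/pred2P[]-> /(_ isT)/pred2P[]-> /(_ isT)/pred2P[]-> /(_ isT)/pred2P[]-> //.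
Qed.

(** With the list {1, 2} on the star, color 2 must be used exactly twice, but a proper coloring of
    the star splits it as one and three. *)
Lemma not_choosable_K13 (G : sgraph) (l : nat) (z u v w : G) :
  uniq [:: z; u; v; w] -> adj z u -> adj z v -> adj z w -> 3 <= l ->
  ~ proportionally_kl_choosable 2 l G.
Proof.
set s := [:: z; u; v; w] => Gu zu zv zw l3 Gch.
pose L (x : G) := [fset 1; if x \in s then 2 else 3]%fset.
have [|f fP] := Gch L.
  split=> x; first by rewrite cardfs2; case: ifP.
  by move=> e; rewrite in_fset2 => /orP[|]/eqP->; [lia|case: ifP; lia].
have [fL fadj _] := fP.
have c2 : count (fun x => f x == 2) s = 2.
  by apply: (count_color fP) => // x; rewrite in_fset2; case: ifP.
have f2 x : x \in s -> (f x == 1) || (f x == 2).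
  by move=> xs; have := fL x; rewrite in_fset2 xs.
have := fadj _ _ zu; have := fadj _ _ zv; have := fadj _ _ zw.
move: (f2 z) (f2 u) (f2 v) (f2 w) c2.
rewrite !inE !eqxx !orbT /=; move: (f z) (f u) (f v) (f w).
by move=> ? ? ? ? /(_ isT)/pred2P[]-> /(_ isT)/pred2P[]-> /(_ isT)/pred2P[]-> /(_ isT)/pred2P[]-> //.
Qed.

(** * Existence of a center *)

Lemma two_coloring_of_choosable (G : sgraph) (l : nat) :
  2 <= l -> proportionally_kl_choosable 2 l G ->
  exists b : G -> bool, forall u v, adj u v -> b u != b v.
Proof.
move=> l2 Gch; have [|f [fL fadj _]] := Gch (fun=> [fset 1; 2]%fset).
  by split=> v; [rewrite cardfs2|move=> c; rewrite in_fset2 => /orP[]/eqP->; lia].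
exists (fun v => f v == 1) => u v /fadj.
by have := fL u; have := fL v; rewrite !in_fset2; lia.
Qed.

(** The center is the middle of a path on five vertices if there is one, otherwise the middle of a
    path on three vertices, otherwise any vertex. *)
Lemma exists_center (G : sgraph) (l : nat) :
  5 <= l -> proportionally_kl_choosable 2 l G ->
  exists z : G, matching_but_center z.
Proof.
move=> l5 Gch; have [|b bP] := two_coloring_of_choosable _ Gch; first by lia.
have l4 : 4 <= l by lia.
have l3 : 3 <= l by lia.
have adjC (u v : G) : adj u v = adj v u by exact: adj_sym.
have adjN (u v : G) : adj u v -> u != v.
  by apply: contraTneq => ->; rewrite adj_irrefl.
have bN (u v : G) : b u != b v -> u != v by apply: contraNneq => ->.
have no_tri (z u v : G) : adj z u -> adj z v -> ~~ adj u v.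
  by move=> /bP zu /bP zv; apply/negP=> /bP; move: zu zv; case: (b z); case: (b u); case: (b v).
have no_K13 (z u v w : G) : adj z u -> adj z v -> adj z w -> [\/ u = v, u = w | v = w].
  move=> zu zv zw; have [uv|uv] := eqVneq u v; first by constructor 1.
  have [uw|uw] := eqVneq u w; first by constructor 2.
  have [vw|vw] := eqVneq v w; first by constructor 3.
  case: (@not_choosable_K13 G l z u v w) => //.
  by rewrite /= !inE !negb_or uv uw vw !adjN.
have no_C4 (u v w x : G) : adj u v -> adj v w -> adj w x -> adj x u ->
    u != w -> v != x -> False.
  move=> uv vw wx xu nuw nvx; case: (@not_choosable_C4 G l u v w x) => //; last by left.
  by rewrite /= !inE !negb_or nuw nvx (adjN _ _ uv) (eq_sym w v) (adjN _ _ vw) (eq_sym u x) (adjN _ _ xu) (adjN _ _ wx).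
have no_2P3 (a1 a2 a3 b1 b2 b3 : G) : adj a1 a2 -> adj a2 a3 -> adj b1 b2 -> adj b2 b3 ->
    a1 != a3 -> b1 != b3 -> a2 != b2 -> a2 != b1 -> a2 != b3 -> b2 != a1 -> b2 != a3 ->
    [&& a1 != b1, a1 != b3, a3 != b1 & a3 != b3] -> False.
  move=> a12 a23 b12 b23 a13 b13 n22 n21 n23 m21 m23 /and4P[n11 n13 n31 n33].
  case: (@not_choosable_2P3 G l a1 a2 a3 b1 b2 b3) => //; last by left.
  rewrite /= !inE !negb_or a13 b13 n22 n21 n23 n11 n13 n31 n33 (eq_sym a1 b2) (eq_sym a3 b2).
  by rewrite m21 m23 (eq_sym a3) (eq_sym b2) !adjN.
(* The 2-coloring [b] settles most disjointness conditions: middles of one class leave the ends, and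
   the middles themselves, to compare; middles of opposite classes leave each middle against the
   ends of the other path. *)
have no_2P3_same (a1 a2 a3 b1 b2 b3 : G) : adj a1 a2 -> adj a2 a3 -> adj b1 b2 ->
    adj b2 b3 -> a1 != a3 -> b1 != b3 -> b a2 = b b2 -> a2 != b2 ->
    [&& a1 != b1, a1 != b3, a3 != b1 & a3 != b3] -> False.
  move=> a12 a23 b12 b23 a13 b13 e n22.
  move: (bP _ _ a12) (bP _ _ a23) (bP _ _ b12) (bP _ _ b23) => h1 h2 h3 h4.
  apply: (no_2P3 a1 a2 a3 b1 b2 b3) => //; apply: bN; move: e h1 h2 h3 h4;
    by case: (b a1); case: (b a2); case: (b a3); case: (b b1); case: (b b2); case: (b b3).
have no_2P3_opp (a1 a2 a3 b1 b2 b3 : G) : adj a1 a2 -> adj a2 a3 -> adj b1 b2 ->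
    adj b2 b3 -> a1 != a3 -> b1 != b3 -> b a2 != b b2 ->
    [&& a2 != b1, a2 != b3, b2 != a1 & b2 != a3] -> False.
  move=> a12 a23 b12 b23 a13 b13 ne /and4P[n21 n23 m21 m23]; apply: (no_2P3 a1 a2 a3 b1 b2 b3) => //; first exact: bN.
  move: ne (bP _ _ a12) (bP _ _ a23) (bP _ _ b12) (bP _ _ b23) => ne h1 h2 h3 h4.
  apply/and4P; split; apply: bN; move: ne h1 h2 h3 h4;
    by case: (b a1); case: (b a2); case: (b a3); case: (b b1); case: (b b2); case: (b b3).
(* A path with middle z. The inequalities are those between vertices of the same class; [b] gives
   the others. *)
pose P5 (x1 x2 z y2 y1 : G) :=
  [&& adj x1 x2 && adj x2 z, adj z y2 && adj y2 y1, x1 != z, x1 != y1 & (z != y1) && (x2 != y2)].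
have no_nbr (z u v w : G) : adj z u -> v != z -> w != z -> v != w ->
    adj u v -> adj u w -> False.
  rewrite adjC => uz vz wz vw uv uw.
  by case: (no_K13 _ _ _ _ uz uv uw) => e; move: vz wz vw; rewrite e eqxx.
(* A second neighbor s of the end x1 either is y2 and closes a C4, or makes s x1 x2 and z y2 y1
   disjoint. *)
have P5_end x1 x2 z y2 y1 v w : P5 x1 x2 z y2 y1 -> adj x1 v -> adj x1 w -> v != w -> False.
  case/and5P=> /andP[x12 x2z] /andP[zy2 y21] nx1z nx1y1 /andP[nzy1 nx2y2] x1v x1w vw.
  have [s x1s sx2] : exists2 s, adj x1 s & s != x2.
    have [vx2|] := eqVneq v x2; last by exists v.
    by exists w; rewrite // -vx2 eq_sym.
  have sy2 : s != y2.
    apply/eqP=> sy2; rewrite sy2 adjC in x1s.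
    exact: (no_C4 _ _ _ _ x12 x2z zy2 x1s nx1z nx2y2).
  apply: (no_2P3_opp s x1 x2 z y2 y1) => //; first by rewrite adjC.
    by move: (bP _ _ x12) (bP _ _ x2z) (bP _ _ zy2); case: (b x1); case: (b x2); case: (b z).
  by rewrite nx1z nx1y1 !(eq_sym y2) sy2.
have P5_center x1 x2 z y2 y1 : P5 x1 x2 z y2 y1 -> matching_but_center z.
  move=> xzy; case/and5P: (xzy) => /andP[x12 x2z] /andP[zy2 y21] nx1z nx1y1 /andP[nzy1 nx2y2].
  split; [|exact: no_K13|exact: no_tri].
  (* The path v u w is shown to be disjoint from x1 x2 z. If u were adjacent to x2, then x2 would
     have three neighbors; if u were adjacent to x1 in the remaining class, then u x1 x2 and z y2 y1
     would be disjoint. *)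
  move=> u v w uz vz wz uv uw; apply/eqP; apply/negPn/negP => vw.
  have ux1 : u != x1 by apply/eqP=> e; apply: (P5_end _ _ _ _ _ v w xzy); rewrite -?e.
  have zu : ~~ adj z u by apply/negP=> zu; apply: (no_nbr z u v w).
  have ux2 : u != x2 by apply: contraNneq zu => ->; rewrite adjC.
  have uy2 : u != y2 by apply: contraNneq zu => ->.
  have nbr_x2 s : adj u s -> s != x2.
    move=> us; apply/eqP=> sx2; rewrite sx2 adjC in us; rewrite adjC in x12.
    by case: (no_K13 _ _ _ _ x12 x2z us) => e; move: nx1z ux1 uz; rewrite e eqxx.
  have bzx : b z = b x1.
    by move: (bP _ _ x12) (bP _ _ x2z); case: (b x1); case: (b x2); case: (b z).
  have bx2 : b x2 != b x1 by rewrite eq_sym bP.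
  have vu : adj v u by rewrite adjC.
  have [bux2|bux2] := eqVneq (b u) (b x2); last first.
    apply: (no_2P3_opp v u w x1 x2 z) => //.
    by rewrite ux1 uz !(eq_sym x2) !nbr_x2.
  have nbr_x1 s : adj u s -> s != x1.
    move=> us; apply/eqP=> sx1; rewrite sx1 in us.
    apply: (no_2P3_opp u x1 x2 z y2 y1) => //.
      by move: (bP _ _ zy2); rewrite bzx.
    by rewrite nx1z nx1y1 !(eq_sym y2) uy2.
  by apply: (no_2P3_same v u w x1 x2 z) => //; rewrite !nbr_x1 ?vz ?wz.
have [/existsP[x1 /existsP[x2 /existsP[z /existsP[y2 /existsP[y1 /P5_center]]]]]|no_P5] :=
  boolP [exists x1, exists x2, exists z, exists y2, exists y1, P5 x1 x2 z y2 y1].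
  by exists z.
have {}no_P5 x1 x2 z y2 y1 : ~~ P5 x1 x2 z y2 y1.
  apply: contra no_P5 => ?; do 5![apply/existsP; eexists]; eassumption.
have [/existsP[z /existsP[y1 /existsP[y2 /and3P[zy1 zy2 y12]]]]|no_P3] :=
  boolP [exists z : G, exists y1, exists y2, [&& adj z y1, adj z y2 & y1 != y2]].
  exists z; split; [|exact: no_K13|exact: no_tri].
  move=> u v w uz vz wz uv uw; apply/eqP; apply/negPn/negP => vw.
  have zu : ~~ adj z u by apply/negP=> zu; apply: (no_nbr z u v w).
  have nbrz s : adj z s -> u != s by apply: contraTneq => <-.
  have vu : adj v u by rewrite adjC.
  have y1z : adj y1 z by rewrite adjC.
  have [buz|buz] := eqVneq (b u) (b z); last first.
    by apply: (no_2P3_opp v u w y1 z y2) => //; rewrite !nbrz // !(eq_sym z) vz wz.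
  (* A common neighbor y of u and z would give the path y' z y u t on five vertices, or a C4 if t =
     y'. *)
  have nbr2 s t y y' : adj u s -> adj u t -> s != t -> adj z y -> adj z y' -> y != y' -> s != y.
    move=> us ut st zy zy' yy'; apply/eqP=> sy; rewrite sy in us st.
    have yu : adj y u by rewrite adjC.
    have y'z : adj y' z by rewrite adjC.
    have ty' : t != y'.
      apply/eqP=> e; rewrite e in ut; rewrite eq_sym in uz.
      exact: (no_C4 _ _ _ _ zy yu ut y'z uz yy').
    have /negP := no_P5 y' z y u t; apply.
    by rewrite /P5 y'z zy yu ut (eq_sym y') yy' (eq_sym y') ty' st eq_sym.
  apply: (no_2P3_same v u w y1 z y2) => //.
  apply/and4P; split.
  - exact: (nbr2 v w y1 y2).
  - by apply: (nbr2 v w y2 y1); rewrite // eq_sym.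
  - by apply: (nbr2 w v y1 y2); rewrite // eq_sym.
  - by apply: (nbr2 w v y2 y1); rewrite // eq_sym.
have /card_gt0P[z _] := vertex_gt0 G; exists z; split; [|exact: no_K13|exact: no_tri].
move=> u v w _ _ _ uv uw; apply/eqP; apply: contraNT no_P3 => vw.
by apply/existsP; exists u; apply/existsP; exists v; apply/existsP; exists w; rewrite uv uw vw.
Qed.

(** * Renaming colors *)

Lemma proportional_coloring_recolor (G : sgraph) (C D : choiceType)
    (s : C -> D) (L : G -> {fset C}) :
  injective s ->
  (exists f, proportional_coloring 2 (fun v => [fset s c | c in L v]%fset) f) ->
  exists f, proportional_coloring 2 L f.
Proof.
move=> s_inj [f [fL fadj fbal]].
have /fin_all_exists[g gP] v : exists c, c \in L v /\ f v = s c.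
  by have /imfsetP[c /= cL ->] := fL v; exists c.
exists g; split=> [v|u v /fadj fuv guv|c /bigfcupP[v /andP[vG _] cv]].
- by case: (gP v).
- by apply: fuv; rewrite (gP u).2 (gP v).2 guv.
have sL w : (s c \in [fset s c | c in L w]%fset) = (c \in L w) by rewrite mem_imfset.
have etaE : eta (fun v => [fset s c | c in L v]%fset) (s c) = eta L c.
  by apply: eq_card => w; rewrite !inE sL.
have -> : #|[pred w | g w == c]| = #|[pred w | f w == s c]|.
  by apply: eq_card => w; rewrite !inE (gP w).2 (inj_eq s_inj).
rewrite -etaE; apply: fbal.
by apply/bigfcupP; exists v; rewrite ?vG // sL.
Qed.

Definition swap (x y n : nat) : nat := if n == x then y else if n == y then x else n.

Lemma swapK x y : involutive (swap x y).
Proof. move=> n; rewrite /swap; do ![case: eqP => //]; lia. Qed.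

(** Two transpositions inside [l] carry the list of [v0] to {1, 2}; the second one fixes 1 because
    [b'] differs from 1. *)
Lemma kl_choosable_first_list (G : sgraph) (v0 : G) (l : nat) : 2 <= l ->
  (forall L : G -> {fset nat}, kl_assignment 2 l L -> L v0 = [fset 1; 2]%fset ->
     exists f, proportional_coloring 2 L f) ->
  proportionally_kl_choosable 2 l G.
Proof.
move=> l2 Gch L [L2 Ll]; have [a [b [ab Lv0]]] := fset_pairP (L2 v0).
have [al bl] : 1 <= a <= l /\ 1 <= b <= l by split; apply: (Ll v0); rewrite Lv0 !inE eqxx ?orbT.
pose b' := swap a 1 b; pose s := swap b' 2 \o swap a 1.
have s_inj : injective s by apply: inj_comp; apply: inv_inj; apply: swapK.
have b'l : 1 <= b' <= l by rewrite /b' /swap; do ![case: eqP => //]; lia.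
apply: (proportional_coloring_recolor s_inj); apply: Gch.
  split=> [v|v c]; first by rewrite card_imfset // L2.
  case/imfsetP=> /= d /Ll dl ->; rewrite /s /swap /=; do ![case: eqP => //]; lia.
rewrite Lv0 imfset_fset2.
have b'1 : 1 <> b' by move/eqP: ab; rewrite /b' /swap; do 2?[case: eqP => // ?]; lia.
have -> : s a = 1 by rewrite /s /= [swap a 1 a]/swap eqxx /swap; case: eqP.
by have -> : s b = 2 by rewrite /s /= -/b' /swap eqxx.
Qed.

(** * Exhaustive search on paths *)

Definition path_adj (n : nat) : rel 'I_n := fun i j => (i.+1 == j) || (j.+1 == i).

Lemma path_adj_sym n : symmetric (@path_adj n).
Proof. by move=> i j; rewrite /path_adj orbC. Qed.

Lemma path_adj_irrefl n : irreflexive (@path_adj n).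
Proof. by move=> i; rewrite /path_adj; lia. Qed.

Lemma ord_card_gt0 n : 0 < #|'I_n.+1|.
Proof. by rewrite card_ord. Qed.

(** The path has n + 1 vertices, so P6 is [path_graph 5] and P7 is [path_graph 6]. *)
Definition path_graph (n : nat) : sgraph :=
  SGraph (@path_adj_sym n.+1) (@path_adj_irrefl n.+1) (ord_card_gt0 n).

Definition list_pairs (l : nat) : seq (nat * nat) :=
  [seq (a, b) | a <- iota 1 l, b <- iota a.+1 (l - a)].

Fixpoint for_all_lists (ps : seq (nat * nat)) (n : nat)
    (P : seq (nat * nat) -> bool) (Ls : seq (nat * nat)) : bool :=
  if n is n'.+1 then all (fun p => for_all_lists ps n' P (p :: Ls)) ps else P Ls.

(** Backtracking along the path: [last] is the color of the previous vertex and [fs] holds the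
    chosen colors in reverse. Nested conditionals stop early under [vm_compute], which evaluates
    both arguments of a boolean connective. *)
Fixpoint search (leaf : seq nat -> bool) (Ls : seq (nat * nat)) (last : nat)
    (fs : seq nat) : bool :=
  if Ls is p :: Ls' then
    if (if eqn last p.1 then false else search leaf Ls' p.1 (p.1 :: fs)) then true
    else if eqn last p.2 then false else search leaf Ls' p.2 (p.2 :: fs)
  else leaf fs.

Definition in_list (c : nat) (p : nat * nat) : bool :=
  if eqn c p.1 then true else eqn c p.2.

(* Colors are positive, so the initial value 0 for the previous color excludes none. *)
Definition path_search (l : nat) (Ls : seq (nat * nat)) : bool :=
  let bounds := [seq let e := count (in_list c) Ls in (c, (e./2, uphalf e)) | c <- iota 1 l] in
  search (fun fs => all (fun b => let k := count (eqn b.1) fs in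
                         if eqn k b.2.1 then true else eqn k b.2.2) bounds) Ls 0 [::].

(* Up to renaming colors, the first list is {1, 2}. *)
Definition path_check (n l : nat) : bool :=
  for_all_lists (list_pairs l) n (fun Ls => path_search l ((1, 2) :: Ls)) [::].

Lemma mem_list_pairs l a b : 1 <= a -> a < b <= l -> (a, b) \in list_pairs l.
Proof.
move=> a1 ab; apply/allpairsPdep; exists a, b; split=> //; rewrite mem_iota; lia.
Qed.

Lemma for_all_listsP ps n P Ls s :
  for_all_lists ps n P Ls -> size s = n -> {subset s <= ps} -> P (s ++ Ls).
Proof.
elim: n Ls s => [|n IHn] Ls s /=; first by move=> + /size0nil ->.
(* The accumulator grows at its head, so the last entry of s is chosen first. *)
case/lastP: s => // s p /allP ps_ok; rewrite size_rcons => -[s_size] s_ps.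
rewrite cat_rcons; apply: IHn => //; first by apply/ps_ok/s_ps; rewrite mem_rcons mem_head.
by move=> q qs; apply: s_ps; rewrite mem_rcons inE qs orbT.
Qed.

Lemma searchP leaf Ls last fs : search leaf Ls last fs ->
  exists gs, [/\ all2 in_list gs Ls, path (fun x y => x != y) last gs & leaf (catrev gs fs)].
Proof.
elim: Ls last fs => [|p Ls IHLs] last fs /=; first by exists [::].
rewrite !eqnE; case: ifP => [|_].
  case: eqP => // /eqP lp /IHLs[gs [gsL gs_path gs_leaf]] _.
  by exists (p.1 :: gs); rewrite /= {1}/in_list eqnE eqxx lp.
case: eqP => // /eqP lp /IHLs[gs [gsL gs_path gs_leaf]].
by exists (p.2 :: gs); rewrite /= {1}/in_list !eqnE eqxx lp if_same.
Qed.

Lemma card_ord_nth (T : Type) (m : nat) (P : pred T) (d : T) (s : seq T) :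
  size s = m -> #|[pred i : 'I_m | P (nth d s i)]| = count P s.
Proof.
move=> <-; rewrite -[in RHS](mkseq_nth d s) /mkseq -val_enum_ord -map_comp count_map.
by rewrite cardE size_filter enumT.
Qed.

Lemma path_choosable (n l : nat) : 2 <= l -> path_check n l ->
  proportionally_kl_choosable 2 l (path_graph n).
Proof.
move=> l2 nl_ok; apply: (@kl_choosable_first_list _ (ord0 : path_graph n)) => // L [L2 Ll] L0.
have /fin_all_exists[p pP] (i : 'I_n.+1) :
    exists p, p \in list_pairs l /\ L i = [fset p.1; p.2]%fset.
  have [a [b [ab Li]]] := fset_pairP (L2 i).
  have [al bl] : 1 <= a <= l /\ 1 <= b <= l.
    by split; apply: (Ll i); rewrite Li !inE eqxx ?orbT.
  have [ltab|leba] := ltnP a b; first by exists (a, b); rewrite mem_list_pairs //; lia.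
  exists (b, a); rewrite mem_list_pairs; [|lia|lia].
  by rewrite Li; split=> //; apply/fsetP=> c; rewrite !inE orbC.
pose Ls := (1, 2) :: [seq p (lift ord0 i) | i <- enum 'I_n].
have sLs : size Ls = n.+1 by rewrite /= size_map size_enum_ord.
have LLs (i : path_graph n) : L i = [fset (nth (1, 2) Ls i).1; (nth (1, 2) Ls i).2]%fset.
  case: (unliftP ord0 i) => [j|] ->; last by rewrite L0.
  rewrite (pP _).2 /= (nth_map j) ?size_enum_ord ?ltn_ord //.
  by rewrite nth_ord_enum.
have mem_L c v : (c \in L v) = in_list c (nth (1, 2) Ls v).
  by rewrite LLs in_fset2 /in_list !eqnE; case: eqP.
have : path_search l Ls.
  have /= := for_all_listsP nl_ok; rewrite /Ls => /(_ [seq p (lift ord0 i) | i <- enum 'I_n]).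
  rewrite cats0; apply; first by rewrite size_map size_enum_ord.
  by move=> _ /mapP[i _ ->]; case: (pP (lift ord0 i)).
case/searchP=> gs [gsL gs_path gs_count].
have sgs : size gs = n.+1 by move: gsL; rewrite all2E sLs => /andP[/eqP].
exists (fun i : 'I_n.+1 => nth 0 gs i); split=> [i|i j ij|c].
- rewrite mem_L; move: gsL; rewrite all2E => /andP[_ /all_nthP].
  move/(_ (0, (1, 2)) i); rewrite size_zip sgs sLs minnn nth_zip ?sgs ?sLs //=.
  by apply.
- move/pathP: gs_path => /(_ 0) gs_path.
  by case/orP: ij => /eqP e; [have := gs_path j|have := gs_path i];
    rewrite -e /= sgs e ltn_ord => /(_ isT)/eqP // ne; apply: nesym.
case/bigfcupP=> v _ /Ll cl.
have -> : #|[pred u : path_graph n | nth 0 gs u == c]| = count (eqn c) gs.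
  rewrite -(card_ord_nth (eqn c) 0 sgs).
  by apply: eq_card => u; rewrite !inE eqnE eq_sym.
have -> : eta L c = count (in_list c) Ls.
  rewrite -(card_ord_nth (in_list c) (1, 2) sLs).
  by apply: eq_card => u; rewrite !inE mem_L.
have c_iota : c \in iota 1 l by rewrite mem_iota; lia.
have /allP/(_ _ (map_f _ c_iota)) := gs_count.
(* The search delivers the colors reversed, which does not affect counts. *)
rewrite -/(rev gs) count_rev /= divn2 /ceil_div addn1 divn2.
by rewrite !eqnE; case: eqP => [->|_ /eqP->]; [left|right].
Qed.

(** * The witnesses C4, P6 and P7 *)

(** C4 is encoded as K_{2,2}, with the parity classes as sides. *)
Definition cycle4_adj : rel 'I_4 := fun i j => odd (i + j).

Lemma cycle4_adj_sym : symmetric cycle4_adj.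
Proof. by move=> i j; rewrite /cycle4_adj addnC. Qed.

Lemma cycle4_adj_irrefl : irreflexive cycle4_adj.
Proof. by move=> i; rewrite /cycle4_adj addnn odd_double. Qed.

Definition cycle4 : sgraph :=
  SGraph cycle4_adj_sym cycle4_adj_irrefl (ord_card_gt0 3).

(** With two colors every list is {1, 2}, and the alternating coloring uses each color twice. *)
Lemma cycle4_choosable : proportionally_kl_choosable 2 2 cycle4.
Proof.
move=> L [L2 Ll].
have LE v : L v = [fset 1; 2]%fset.
  have [a [b [ab Lv]]] := fset_pairP (L2 v).
  have [al bl] : 1 <= a <= 2 /\ 1 <= b <= 2.
    by split; apply: (Ll v); rewrite Lv !inE eqxx ?orbT.
  by apply: fset_pair_eq => //; rewrite Lv !inE; move: ab; lia.
exists (fun v : 'I_4 => (odd v).+1); split=> [v|u v|c /bigfcupP[v _]].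
- by rewrite LE !inE; case: odd.
- by rewrite /= /cycle4_adj oddD; case: odd; case: odd.
rewrite LE !inE => c12.
have -> : eta L c = 4.
  by rewrite -[4]card_ord; apply: eq_card => u; rewrite !inE LE !inE c12.
left; case/orP: c12 => /eqP->.
  by rewrite -sum1_card big_mkcond !big_ord_recl big_ord0.
by rewrite -sum1_card big_mkcond !big_ord_recl big_ord0.
Qed.

Lemma cycle4_not_choosable : ~ proportionally_kl_choosable 2 3 cycle4.
Proof.
pose v k (k4 : k < 4) := Ordinal k4 : cycle4.
apply: (@not_choosable_C4 cycle4 3 (v 0 isT) (v 1 isT) (v 2 isT) (v 3 isT)) => //.
by right=> -[[|[|[|[|]]]] //].
Qed.

Lemma path6_choosable : proportionally_kl_choosable 2 3 (path_graph 5).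
Proof. by apply: path_choosable; [|vm_compute]. Qed.

Lemma path7_choosable : proportionally_kl_choosable 2 4 (path_graph 6).
Proof. by apply: path_choosable; [|vm_compute]. Qed.

Lemma path6_not_choosable : ~ proportionally_kl_choosable 2 4 (path_graph 5).
Proof.
pose v k (k6 : k < 6) := Ordinal k6 : path_graph 5.
apply: (@not_choosable_2P3 (path_graph 5) 4 (v 0 isT) (v 1 isT) (v 2 isT)
  (v 3 isT) (v 4 isT) (v 5 isT)) => //.
by right=> -[[|[|[|[|[|[|]]]]]] //].
Qed.

(** The seventh vertex lies outside both paths, and its list takes the fifth color. *)
Lemma path7_not_choosable : ~ proportionally_kl_choosable 2 5 (path_graph 6).
Proof.
pose v k (k7 : k < 7) := Ordinal k7 : path_graph 6.
apply: (@not_choosable_2P3 (path_graph 6) 5 (v 0 isT) (v 1 isT) (v 2 isT)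
  (v 3 isT) (v 4 isT) (v 5 isT)) => //.
by left.
Qed.

(** * Comparison of the classes *)

Lemma kl_choosable_le (k l l' : nat) (G : sgraph) : l <= l' ->
  proportionally_kl_choosable k l' G -> proportionally_kl_choosable k l G.
Proof. by move=> ll' Gch L [Lk Ll]; apply: Gch; split=> // v c /Ll; lia. Qed.

Lemma choosable_kl (k l : nat) (G : sgraph) :
  proportionally_choosable k G -> proportionally_kl_choosable k l G.
Proof. by move=> Gch L [Lk _]; apply: Gch. Qed.


Theorem mainTheorem4 :
  [/\ strict_superset (proportionally_kl_choosable 2 2) (proportionally_kl_choosable 2 3),
      strict_superset (proportionally_kl_choosable 2 3) (proportionally_kl_choosable 2 4),
      strict_superset (proportionally_kl_choosable 2 4) (proportionally_kl_choosable 2 5)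
    & forall l : nat, 5 <= l ->
        same_graphs (proportionally_kl_choosable 2 l) (proportionally_choosable 2)].
Proof.
split; last 1 first.
- move=> l l5 G; split; last exact: choosable_kl.
  by move/(exists_center l5)=> [z]; apply: choosable_of_center.
- split; first by move=> G; apply: kl_choosable_le.
  by exists cycle4; split; [exact: cycle4_choosable|exact: cycle4_not_choosable].
- split; first by move=> G; apply: kl_choosable_le.
  by exists (path_graph 5); split; [exact: path6_choosable|exact: path6_not_choosable].
split; first by move=> G; apply: kl_choosable_le.
by exists (path_graph 6); split; [exact: path7_choosable|exact: path7_not_choosable].
Qed.
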